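(* Let $n\ge 2$ be an integer and let $SD_{8n}=\langle x,y : x^{4n}=y^2=1,\ yxy=x^{2n-1}\rangle$ be the semidihedral group of order $8n$. Then the CN-spectrum and CN-energy of its commuting conjugacy class graph are $$\text{CN-spec}(\Gamma(SD_{8n}))=\begin{cases} \{(-(2n-3))^{(2n-2)},\ ((2n-2)(2n-3))^1,\ 0^2\}, & \text{if } 2\mid n,\\ \{(-(2n-4))^{(2n-3)},\ ((2n-3)(2n-4))^1,\ (-2)^3,\ 6^1\}, & \text{if } 2\nmid n, \end{cases}$$ and $$E_{CN}(\Gamma(SD_{8n}))=\begin{cases} 2(2n-2)(2n-3), & \text{if } 2\mid n,\\ 2(2n-3)(2n-4)+12, & \text{if } 2\nmid n. \end{cases}$$
   Context: For a finite non-abelian group $G$, the commuting conjugacy class graph $\Gamma(G)$ is the simple undirected graph whose vertices are the conjugacy classes of the non-central elements of $G$; two distinct vertices $a^G$ and $b^G$ are adjacent if there exist $a'\in a^G$, $b'\in b^G$ with $a'b'=b'a'$. For a finite simple graph $\mathcal{G}$ with vertices $v_1,\dots,v_N$, the common neighbourhood matrix $CN(\mathcal{G})$ is the $N\times N$ matrix whose $(i,j)$ entry is, for $i\ne j$, the number of vertices other than $v_i,v_j$ adjacent to both $v_i$ and $v_j$, and is $0$ for $i=j$. The CN-spectrum $\text{CN-spec}(\mathcal{G})$ is the multiset of eigenvalues of $CN(\mathcal{G})$; writing $\{\lambda_1^{\alpha_1},\dots,\lambda_k^{\alpha_k}\}$ means that $\lambda_i$ is listed $\alpha_i$ times (multiplicities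 of coinciding values add up; entries with exponent $0$ are absent). The CN-energy $E_{CN}(\mathcal{G})$ is the sum of the absolute values of the eigenvalues of $CN(\mathcal{G})$, counted with multiplicity. *)

(* Defs.v *)
From HB Require Import structures.
From mathcomp Require Import all_boot all_order all_fingroup all_algebra.
From mathcomp Require Import all_solvable.

Set Implicit Arguments.
Unset Strict Implicit.
Unset Printing Implicit Defensive.

Import Order.TTheory GRing.Theory Num.Theory.

Record sgraph := SGraph {
  vertex : finType;
  adj : rel vertex;
  adj_sym : symmetric adj;
  adj_irr : irreflexive adj
}.

Section CommutingConjugacyClassGraph.

Variables (gT : finGroupType) (G : {group gT}).

Local Open Scope group_scope.

Definition noncentral_classes : {set {set gT}} :=
  [set a ^: G | a in G :\: 'Z(G)].

Definition ccc_vertex : finType := {A : {set gT} | A \in noncentral_classes}.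

Definition ccc_adj : rel ccc_vertex := fun A B =>
  (A != B) && [exists a in val A, exists b in val B, a * b == b * a].

Lemma ccc_adj_sym : symmetric ccc_adj.
Proof.
suff sub A B : ccc_adj A B -> ccc_adj B A.
  by move=> A B; apply/idP/idP; exact: sub.
case/andP=> nAB /exists_inP[a Aa /exists_inP[b Bb cab]].
rewrite /ccc_adj eq_sym nAB /=.
by apply/exists_inP; exists b => //; apply/exists_inP; exists a => //;
  rewrite eq_sym.
Qed.

Lemma ccc_adj_irr : irreflexive ccc_adj.
Proof. by move=> A; rewrite /ccc_adj eqxx. Qed.

Definition ccc_graph : sgraph := SGraph ccc_adj_sym ccc_adj_irr.

End CommutingConjugacyClassGraph.

Local Open Scope ring_scope.

Section CommonNeighbourhood.

Variable C : numClosedFieldType.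

(* The vertices v_1, ..., v_N are listed in the order of [enum_val]; the
   spectrum does not depend on this order. *)
Definition CN_matrix (g : sgraph) : 'M[C]_#|vertex g| :=
  \matrix_(i, j)
    let u := enum_val i in let v := enum_val j in
    if i == j then 0
    else #|[set w : vertex g |
             [&& w != u, w != v, adj w u & adj w v]]|%:R.

(* The eigenvalues listed with multiplicity, in an unspecified order: the
   roots of the characteristic polynomial, which splits over C. *)
Definition eigenvalues n (A : 'M[C]_n) : seq C :=
  sval (closed_field_poly_normal (char_poly A)).

Definition CN_spec (g : sgraph) : seq C := eigenvalues (CN_matrix g).

Definition CN_energy (g : sgraph) : C := \sum_(a <- CN_spec g) `|a|.

End CommonNeighbourhood.

(* Main.v *)
Require Import Defs.
From HB Require Import structures.
From mathcomp Require Import all_boot all_order all_fingroup all_algebra.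
From mathcomp Require Import all_solvable.
From mathcomp Require Import zify ring.
Import Order.TTheory GRing.Theory Num.Theory.
Local Open Scope ring_scope.

(** The commuting conjugacy class graph of the semidihedral group is a disjoint
union of cliques, and the common neighbourhood matrix of such a graph is block
diagonal, with one block (k - 2)(J - I) for each clique of size k.  Such a block
has the eigenvalue (k - 1)(k - 2) once and 2 - k with multiplicity k - 1, so the
spectrum depends only on the clique sizes ([CN_spec_cliques]), and a clique of
size k contributes 2(k - 1)(k - 2) to the energy ([clique_CN_energy]).

The cliques come from the abelian subgroup H = <x> of index 2.  Whenever a
nonabelian group G has an abelian subgroup H of index 2, its centre Z lies in H,
and an element of H commuting with one outside H is central; hence no class
inside H is adjacent to a class outside H.  The classes inside H are pairwise
adjacent, and the noncentral ones have 2 elements each, so there are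
(|H| - |Z|) / 2 of them ([card_inside_vertices]).  The centraliser of b outside
H is the union of Z and Z b, so its class has |H| / |Z| elements and there are
|Z| classes outside H ([card_outside_vertices]).

In SD_8n an element outside H conjugates x to x^(2n - 1), so the class of b
contains all b x^(j(2n - 2)), and x^i is central exactly when 4n divides
i(2n - 2).  If n is even, Z = {1, x^2n}, and b and b x^2n are conjugate, hence
the two outer classes are isolated vertices: the clique sizes are 2n - 1, 1, 1.
If n is odd, Z = <x^n> has order 4, and the powers x^(j(2n - 2)) together with Z
generate H, hence the four outer classes form a clique: the clique sizes are
2n - 2 and 4.

The presentation bounds |G| by 8n from above; the matching lower bound is
obtained from a semidirect product of cyclic groups of orders 4n and 2 that
satisfies the relations ([semidihedral_model]). *)

Set Implicit Arguments.
Unset Strict Implicit.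
Unset Printing Implicit Defensive.

(** * The common neighbourhood spectrum of a disjoint union of cliques *)

(** A form of the Weinstein-Aronszajn identity det (1 - W V) = det (1 - V W)
that needs no inverse: when V intertwines D and D', both sides are the
determinant of the product of the block matrices (1, 0; -V, D') and
(D, W; V, 1).  Avoiding inverses lets it apply to characteristic matrices,
whose entries are polynomials. *)
Lemma det_sub_mul (R : comNzRingType) (n p : nat)
    (D : 'M[R]_n) (D' : 'M[R]_p) (W : 'M[R]_(n, p)) (V : 'M[R]_(p, n)) :
  V *m D = D' *m V ->
  \det D' * \det (D - W *m V) = \det D * \det (D' - V *m W).
Proof.
move=> VD.
pose M := block_mx D W V 1%:M.
have detM : \det M = \det (D - W *m V).
  have -> : M = block_mx (D - W *m V) W 0 1%:M *m block_mx 1%:M 0 V 1%:M.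
    by rewrite mulmx_block !(mulmx1, mulmx0, mul0mx, mul1mx) subrK !add0r.
  by rewrite det_mulmx det_ublock det_lblock !det1 !mulr1.
have : \det (block_mx 1%:M 0 (- V) D' *m M) = \det D * \det (D' - V *m W).
  rewrite mulmx_block !(mul0mx, mul1mx, mulmx1, mulNmx) VD addNr !addr0.
  by rewrite det_ublock addrC.
by rewrite det_mulmx det_lblock det1 mul1r detM.
Qed.

(** The spectrum of (k - 2)(J - I), for J the all-ones matrix of size k. *)
Definition clique_CN_spec (C : numClosedFieldType) (k : nat) : seq C :=
  nseq k.-1 (2 - k%:R) ++ [:: (k%:R - 1) * (k%:R - 2)].

Lemma char_poly_eigenvalues (C : numClosedFieldType) n (A : 'M[C]_n) :
  char_poly A = \prod_(z <- eigenvalues A) ('X - z%:P).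
Proof.
rewrite /eigenvalues; case: closed_field_poly_normal => s /= def_s.
by rewrite {1}def_s (monicP (char_poly_monic A)) scale1r.
Qed.

Section CliquePartition.

Variables (C : numClosedFieldType) (g : sgraph) (P : {set {set vertex g}}).
(* Together: the graph is the disjoint union of complete graphs on the blocks
   of P. *)
Hypothesis partP : partition P [set: vertex g].
Hypothesis adjP : forall u v : vertex g, adj u v = (u != v) && (v \in pblock P u).

Lemma card_common_neighbours (u v : vertex g) : u != v ->
  #|[set w : vertex g | [&& w != u, w != v, adj w u & adj w v]]| =
  (if v \in pblock P u then #|pblock P u| - 2 else 0)%N.
Proof.
move=> neq_uv; have [/eqP covP tiP _] := and3P partP.
have mem_cov w : w \in cover P by rewrite covP inE.
have swap w z : (z \in pblock P w) = (w \in pblock P z).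
  by rewrite -!eq_pblock // eq_sym.
case: ifPn => [uv | nuv].
  have -> : [set w | [&& w != u, w != v, adj w u & adj w v]]
            = pblock P u :\: [set u; v].
    apply/setP=> w; rewrite !inE !adjP negb_or -andbA.
    case: (w != u) => //=; case: (w != v) => //=.
    rewrite !(swap w) (same_pblock tiP uv).
    exact: andbb.
  rewrite cardsD (setIidPr _) ?cards2 ?neq_uv //.
  by apply/subsetP=> w; rewrite !inE => /orP[] /eqP->; rewrite // mem_pblock.
apply/eqP; rewrite cards_eq0; apply/eqP/setP=> w; rewrite !inE !adjP.
apply: contraNF nuv => /and4P[_ _ /andP[_ wu] /andP[_ wv]].
move: wu; rewrite -!eq_pblock // => /eqP <-; rewrite eq_pblock //.
Qed.

(** Let W be the incidence matrix between vertices and blocks.  The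
characteristic matrix is D - W S W^T, where D = diag ('X + k - 2) over the
vertices and S = diag (k - 2) over the blocks, k being the size of the block
concerned.  Since W^T W = diag k, exchanging the factors by [det_sub_mul] with
V = S W^T leaves only diagonal determinants, indexed by the blocks. *)
Lemma char_poly_CN :
  char_poly (CN_matrix C g) =
  \prod_(B in P) (('X - (2 - #|B|%:R)%:P) ^+ #|B|.-1
                  * ('X - ((#|B|%:R - 1) * (#|B|%:R - 2))%:P)).
Proof.
have [/eqP covP tiP P0] := and3P partP.
have mem_cov w : w \in cover P by rewrite covP inE.
pose d (B : {set vertex g}) : {poly C} := 'X - (2 - #|B|%:R)%:P.
pose s (B : {set vertex g}) : {poly C} := (#|B|%:R - 2)%:P.
pose D : 'M[{poly C}]_#|vertex g| := diag_mx (\row_i d (pblock P (enum_val i))).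
pose D' : 'M[{poly C}]_#|P| := diag_mx (\row_j d (enum_val j)).
pose W : 'M[{poly C}]_(#|vertex g|, #|P|) :=
  \matrix_(i, j) ((enum_val i : vertex g) \in (enum_val j : {set vertex g}))%:R.
pose V : 'M[{poly C}]_(#|P|, #|vertex g|) := diag_mx (\row_j s (enum_val j)) *m W^T.
have pbE (i : 'I_#|vertex g|) (j : 'I_#|P|) :
    ((enum_val i : vertex g) \in (enum_val j : {set vertex g}))
    = (enum_val j == pblock P (enum_val i)).
  apply/idP/eqP => [ij | ->]; last by rewrite mem_pblock.
  by rewrite (def_pblock tiP _ ij) // enum_valP.
have VE j i : V j i = (enum_val j == pblock P (enum_val i))%:R * s (enum_val j).
  by rewrite /V mul_diag_mx !mxE pbE mulrC.
have WE i j : W i j = (enum_val j == pblock P (enum_val i))%:R.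
  by rewrite mxE pbE.
clearbody V W.
have VD : V *m D = D' *m V.
  apply/matrixP=> j i; rewrite mul_mx_diag mul_diag_mx !mxE VE.
  by case: eqP => [-> | _]; rewrite ?mul1r ?mul0r ?mulr0 // mulrC.
have WV : char_poly_mx (CN_matrix C g) = D - W *m V.
  apply/matrixP=> i k; rewrite !mxE.
  under eq_bigr => j _ do rewrite VE WE.
  have pk : pblock P (enum_val i) \in P by apply: pblock_mem.
  rewrite (bigD1 (enum_rank_in pk (pblock P (enum_val i)))) //=.
  rewrite enum_rankK_in // eqxx mul1r big1 ?addr0; last first.
    move=> j neq_j; case: eqP => [eq_j | _]; last by rewrite mul0r.
    by case/eqP: neq_j; apply: enum_val_inj; rewrite enum_rankK_in.
  have [<- | neq_ik] := eqVneq i k.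
    rewrite eqxx mulr1n mul1r subr0 /d /s -addrA -opprD -polyCD.
    by rewrite -(opprB 2 #|_|%:R) subrr subr0.
  rewrite mulr0n card_common_neighbours ?(inj_eq enum_val_inj) //.
  rewrite -eq_pblock //; case: eqP => [eq_p | _]; rewrite ?mul0r // mul1r /s.
  rewrite natrB //; suff: [set enum_val i; enum_val k] \subset pblock P (enum_val i).
    by move/subset_leq_card; rewrite cards2 (inj_eq enum_val_inj) neq_ik.
  apply/subsetP=> w; rewrite !inE => /orP[] /eqP->; first by rewrite mem_pblock.
  by rewrite eq_p mem_pblock.
have detD' : \det D' = \prod_(B in P) d B.
  by rewrite det_diag [RHS]big_enum_val; apply: eq_bigr => j _; rewrite mxE.
have detD : \det D = \prod_(B in P) d B ^+ #|B|.
  rewrite det_diag (eq_bigr (fun i => d (pblock P (enum_val i)))); last first.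
    by move=> i _; rewrite mxE.
  rewrite -(big_enum_val (fun v => d (pblock P v))) /=.
  rewrite (eq_bigl (mem (cover P))) => [|v]; last exact/esym/mem_cov.
  rewrite big_trivIset //; apply: eq_bigr => B PB; rewrite -prodr_const.
  by apply: eq_bigr => v Bv; rewrite (def_pblock tiP PB Bv).
have detVW : \det (D' - V *m W)
    = \prod_(B in P) ('X - ((#|B|%:R - 1) * (#|B|%:R - 2))%:P).
  pose e (B : {set vertex g}) : {poly C} :=
    'X - ((#|B|%:R - 1) * (#|B|%:R - 2))%:P.
  have -> : D' - V *m W = diag_mx (\row_j e (enum_val j)).
    apply/matrixP=> j k; rewrite !mxE.
    under eq_bigr => i _ do rewrite VE WE.
    have [<- | neq_jk] := eqVneq j k.
      rewrite !mulr1n (eq_bigr (fun i => if enum_val i \in (enum_val j : {set vertex g})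
        then s (enum_val j) else 0)) => [|i _]; last first.
        by rewrite pbE; case: eqP; rewrite ?mul1r ?mulr1 ?mul0r.
      rewrite -(big_enum_val (fun v => if v \in enum_val j then s (enum_val j) else 0)).
      rewrite -big_mkcondr sumr_const /=.
      rewrite /d /s /e -polyCMn -addrA -opprD -polyCD.
      by rewrite mulrBl mul1r mulr_natl opprB [(2 - _) + _]addrC.
    rewrite !mulr0n big1 ?subr0 // => i _.
    case: eqP => [<- | _]; last by rewrite !mul0r.
    by rewrite (inj_eq enum_val_inj) eq_sym (negPf neq_jk) mulr0.
  by rewrite det_diag [RHS]big_enum_val; apply: eq_bigr => j _; rewrite mxE.
have d_neq0 B : d B != 0 by rewrite polyXsubC_eq0.
have D'_neq0 : \det D' != 0 by rewrite detD'; apply/prodf_neq0=> B _.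
apply: (mulfI D'_neq0).
rewrite /char_poly WV (det_sub_mul W VD) detD detVW detD' -!big_split /=.
apply: eq_bigr => B PB; rewrite mulrA -exprS prednK // card_gt0.
by apply: contraNneq P0 => <-.
Qed.

Lemma CN_spec_cliques (sizes : seq nat) :
    perm_eq [seq #|B| | B : {set vertex g} <- enum P] sizes ->
  perm_eq (CN_spec C g) (flatten [seq clique_CN_spec C k | k <- sizes]).
Proof.
move=> sizesP.
have Pflat : perm_eq (flatten [seq clique_CN_spec C #|B| | B : {set vertex g} <- enum P])
                     (flatten [seq clique_CN_spec C k | k <- sizes]).
  by apply: perm_flatten; rewrite (map_comp (clique_CN_spec C)) perm_map.
apply: perm_trans Pflat; apply: prod_XsubC_eq.
rewrite big_flatten big_map big_enum /=.
rewrite -char_poly_eigenvalues char_poly_CN; apply: eq_bigr => B _.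
by rewrite big_cat big_nseq big_seq1 iter_mulr_1.
Qed.

End CliquePartition.

(** * Conjugacy classes of a group with an abelian subgroup of index two *)

Section AbelianIndexTwo.

Local Open Scope group_scope.

Variables (gT : finGroupType) (G H : {group gT}).
Hypotheses (sHG : H \subset G) (abH : abelian H) (iHG : #|G : H| = 2).
Hypothesis nabG : ~~ abelian G.

Local Notation Z := 'Z(G).

Lemma cardG_index2 : #|G| = (2 * #|H|)%N.
Proof. by rewrite -(Lagrange sHG) iHG mulnC. Qed.

Lemma index2_overgroup (K : {group gT}) (b : gT) :
  H \subset K -> K \subset G -> b \in K -> b \notin H -> K :=: G.
Proof.
move=> sHK sKG Kb nHb.
have /maxgroupP[_ maxH] : maximal H G by rewrite p_index_maximal ?iHG.
apply/eqP; rewrite eqEproper sKG; apply/negP=> prKG.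
by rewrite -(maxH K prKG sHK) Kb in nHb.
Qed.

(** The centraliser of h contains H and b, hence is all of G because H is
maximal. *)
Lemma commuting_outside_central (h b : gT) :
  h \in H -> b \in G :\: H -> commute b h -> h \in Z.
Proof.
move=> Hh /setDP[Gb nHb] cbh.
have CG : 'C_G[h] = G.
  apply: (@index2_overgroup _ b); rewrite ?subsetIl //.
    by rewrite subsetI sHG sub_cent1 (subsetP abH).
  by rewrite inE Gb cent1C; apply/cent1P.
by rewrite inE (subsetP sHG) //= -sub_cent1 -CG subsetIr.
Qed.

(** A central element outside H would commute with all of H, making H central
by [commuting_outside_central], and then G = Z. *)
Lemma center_sub_index2 : Z \subset H.
Proof.
apply/subsetP=> z Zz; apply: contraR nabG => nHz.
have Gz := subsetP (center_sub G) z Zz.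
have sHZ : H \subset Z.
  apply/subsetP=> h Hh; apply: (@commuting_outside_central h z) => //.
    by rewrite inE nHz.
  exact/esym/(centerC (subsetP sHG h Hh) Zz).
rewrite -(index2_overgroup sHZ (center_sub G) Zz nHz); exact: center_abelian.
Qed.

(** By [commuting_outside_central] the centraliser of h is H itself. *)
Lemma card_class_inside (h : gT) : h \in H :\: Z -> #|h ^: G| = 2.
Proof.
case/setDP=> Hh nZh; rewrite -index_cent1 -iHG; congr #|G : _|.
have sHC : H \subset 'C_G[h] by rewrite subsetI sHG sub_cent1 (subsetP abH).
apply/eqP; rewrite eqEsubset sHC andbT; apply/subsetP=> b; rewrite inE => /andP[Gb].
move/cent1P=> cbh; apply: contraR nZh => nHb.
by apply: (commuting_outside_central Hh _ cbh); rewrite inE nHb.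
Qed.

(** The centraliser C of b meets H in Z and H C = G, so |C| = 2 |Z|. *)
Lemma card_class_outside (b : gT) :
  b \in G :\: H -> (#|b ^: G| * #|Z|)%N = #|H|.
Proof.
move=> GHb; have /setDP[Gb nHb] := GHb.
have HC : H :&: 'C_G[b] = Z.
  apply/setP=> h; apply/idP/idP=> [|Zh].
    case/setIP=> Hh /setIP[_ /cent1P cbh].
    exact: (commuting_outside_central Hh GHb (esym cbh)).
  apply/setIP; split; first exact: (subsetP center_sub_index2).
  apply/setIP; split; first exact: (subsetP (center_sub G)).
  by apply/cent1P; exact/esym/(centerC Gb Zh).
have HCG : H * 'C_G[b] = G.
  rewrite -norm_joinEr; last first.
    by rewrite (subset_trans (subsetIl _ _)) // normal_norm // index2_normal.
  apply: (@index2_overgroup _ b) => //; first exact: joing_subl.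
    by rewrite join_subG sHG subsetIl.
  by rewrite (subsetP (joing_subr _ _)) // inE Gb cent1id.
have := mul_cardG H 'C_G[b]; rewrite HCG HC -(Lagrange (subsetIl G 'C[b])).
rewrite index_cent1 -mulnA [(#|H| * _)%N]mulnC => /eqP.
by rewrite eqn_pmul2l ?cardG_gt0 // => /eqP.
Qed.

Lemma classes_in_partition (D : {set gT}) :
  D \subset G -> G \subset 'N(D) -> partition [set a ^: G | a in D] D.
Proof.
move=> sDG nDG; rewrite -(eq_imset _ (orbitJ G)).
by apply: orbit_partition; rewrite astabsJ.
Qed.

Lemma card_classes_inside : (2 * #|[set a ^: G | a in H :\: Z]| = #|H| - #|Z|)%N.
Proof.
have nHG : H <| G by apply: index2_normal.
have P : partition [set a ^: G | a in H :\: Z] (H :\: Z).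
  apply: classes_in_partition; first by rewrite subDset subsetU // sHG orbT.
  by rewrite normsD ?normal_norm ?center_normal.
rewrite mulnC -(card_uniform_partition _ P) => [|A /imsetP[a Da ->]].
  by rewrite cardsD (setIidPr center_sub_index2).
exact: card_class_inside.
Qed.

(** The |H| elements outside H split into classes of size |H| / |Z|. *)
Lemma card_classes_outside : #|[set a ^: G | a in G :\: H]| = #|Z|.
Proof.
have nHG : H <| G by apply: index2_normal.
have P : partition [set a ^: G | a in G :\: H] (G :\: H).
  apply: classes_in_partition; first exact: subsetDl.
  by rewrite normsD ?normG ?normal_norm.
have := card_uniform_partition _ P => /(_ (#|H| %/ #|Z|)%N).
have dZH : (#|Z| %| #|H|)%N by apply: cardSg center_sub_index2.
rewrite cardsD (setIidPr sHG) cardG_index2 mul2n -addnn addnK => cardP.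
apply/eqP; rewrite -(eqn_pmul2r (cardG_gt0 H)) [X in X == _]mulnC.
rewrite -{1}(divnK dZH) mulnAC [X in (X * _)%N]mulnC -cardP 1?mulnC //.
move=> A /imsetP[a Da ->]; rewrite -(card_class_outside Da).
by rewrite mulnK ?cardG_gt0.
Qed.

Definition inside_vertices : {set ccc_vertex G} :=
  [set A : ccc_vertex G | (val A : {set gT}) \subset H].

Lemma class_inside (a : gT) : a \in G -> (a ^: G \subset H) = (a \in H).
Proof.
move=> Ga; apply/subsetP/idP=> [-> // | Ha b /imsetP[g Gg ->]].
  exact: class_refl.
by rewrite memJ_norm // (subsetP (normal_norm (index2_normal sHG iHG))).
Qed.

Lemma vertexP (A : ccc_vertex G) :
  exists2 a, a \in G :\: Z & val A = a ^: G.
Proof. by have /imsetP := valP A. Qed.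

Lemma card_inside_vertices : (2 * #|inside_vertices| = #|H| - #|Z|)%N.
Proof.
rewrite -card_classes_inside -(card_imset _ val_inj); congr (2 * #|pred_of_set _|)%N.
apply/setP=> B; apply/imsetP/imsetP=> [[A] | [a /setDP[Ha nZa] ->]].
  rewrite inE; have [a /setDP[Ga nZa] ->] := vertexP A.
  by rewrite class_inside // => Ha ->; exists a; rewrite // inE nZa.
have Ga := subsetP sHG a Ha.
have vB : a ^: G \in noncentral_classes G by apply: imset_f; rewrite inE nZa.
by exists (Sub (a ^: G) vB); rewrite ?inE //= class_inside.
Qed.

Lemma card_outside_vertices : #|~: inside_vertices| = #|Z|.
Proof.
rewrite -card_classes_outside -(card_imset _ val_inj); congr #|pred_of_set _|.
apply/setP=> B; apply/imsetP/imsetP=> [[A] | [a /setDP[Ga nHa] ->]].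
  rewrite !inE; have [a /setDP[Ga nZa] ->] := vertexP A.
  by rewrite class_inside // => Ha ->; exists a; rewrite // inE Ha.
have nZa := contra (subsetP center_sub_index2 a) nHa.
have vB : a ^: G \in noncentral_classes G by apply: imset_f; rewrite inE nZa.
by exists (Sub (a ^: G) vB); rewrite ?inE //= class_inside.
Qed.

(** * The graph of a group with an abelian subgroup of index two *)

(** If a class outside H met the centraliser of an element of A, that element
would be central by [commuting_outside_central]; inside the abelian group H
everything commutes. *)
Lemma adj_inside (A B : ccc_vertex G) : A \in inside_vertices ->
  ccc_adj A B = (A != B) && (B \in inside_vertices).
Proof.
rewrite /ccc_adj !inE => sAH; congr (_ && _).
have [a /setDP[Ga nZa] defA] := vertexP A.
have [b /setDP[Gb nZb] defB] := vertexP B.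
apply/exists_inP/idP=> [[a' Aa' /exists_inP[b' Bb' /eqP cab]] | sBH].
  have Ha' := subsetP sAH a' Aa'.
  have Gb' : b' \in G by rewrite defB in Bb'; apply: subsetP Bb'; rewrite class_subG.
  have -> : val B = b' ^: G by rewrite defB in Bb' *; apply/esym/class_eqP.
  rewrite class_inside //; apply: contraR nZa => nHb'.
  have : a' \in Z.
    by apply: (commuting_outside_central (b := b')); rewrite ?inE ?nHb'.
  rewrite defA in Aa'; case/imsetP: Aa' => g Gg ->.
  by rewrite memJ_norm // (subsetP (normal_norm (center_normal G))).
have Aa : a \in val A by rewrite defA class_refl.
have Bb : b \in val B by rewrite defB class_refl.
exists a => //; apply/exists_inP; exists b => //.
exact/eqP/(centsP abH _ (subsetP sAH a Aa) _ (subsetP sBH b Bb)).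
Qed.

Lemma outside_mem (A : ccc_vertex G) (a : gT) :
  A \notin inside_vertices -> a \in val A -> a \in G :\: H.
Proof.
have [b /setDP[Gb _] defA] := vertexP A.
rewrite inE defA => nAH Aa; have sAG : b ^: G \subset G by rewrite class_subG.
have Ga := subsetP sAG a Aa; rewrite inE Ga andbT -class_inside //.
by rewrite (class_eqP Aa).
Qed.

Lemma adj_outside_inside (A B : ccc_vertex G) :
  A \notin inside_vertices -> B \in inside_vertices -> ccc_adj A B = false.
Proof.
by move=> nAH BH; rewrite ccc_adj_sym adj_inside // (negPf nAH) andbF.
Qed.

(** The conjugacy hypothesis isolates every outer class, so the blocks are the
inner classes, taken together, and the |Z| singletons of outer classes; a
clique of size 1 contributes the eigenvalue 0. *)
Lemma CN_spec_isolated_outside (C : numClosedFieldType) :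
    inside_vertices != set0 ->
    {in G :\: H &, forall b c, commute b c -> c \in b ^: G} ->
  perm_eq (CN_spec C (ccc_graph G))
          (clique_CN_spec C #|inside_vertices| ++ nseq #|Z| 0%R).
Proof.
move=> in_neq0 conj_out; pose S := [set [set A] | A in ~: inside_vertices].
have SP B : B \in S -> exists2 A, A \notin inside_vertices & B = [set A].
  by case/imsetP=> A; rewrite inE; exists A.
have tiS : trivIset S.
  apply/trivIsetP=> _ _ /SP[A _ ->] /SP[B _ ->] neqAB.
  by rewrite disjoints1 inE; apply: contraNneq neqAB => ->.
have disS : {in S, forall B : {set _}, [disjoint inside_vertices & B]}.
  by move=> _ /SP[A nA ->]; rewrite disjoint_sym disjoints1.
have S0 : set0 \notin S.
  by apply/negP=> /SP[A _ /setP/(_ A)]; rewrite !inE eqxx.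
have [tiP inP] := trivIsetU1 disS tiS S0.
have outP A : A \notin inside_vertices -> [set A] \in inside_vertices |: S.
  by move=> nA; rewrite setU1r // imset_f // inE.
have partP : partition (inside_vertices |: S) [set: vertex (ccc_graph G)].
  apply/and3P; split=> //; last by rewrite in_setU1 negb_or eq_sym in_neq0.
  apply/eqP/setP=> A; rewrite [RHS]inE; apply/bigcupP.
  have [AH | nAH] := boolP (A \in inside_vertices).
    by exists inside_vertices; rewrite ?setU11.
  by exists [set A]; rewrite ?outP ?set11.
have adjP (A B : vertex (ccc_graph G)) :
    adj A B = (A != B) && (B \in pblock (inside_vertices |: S) A).
  have [AH | nAH] := boolP (A \in inside_vertices).
    by rewrite [LHS]adj_inside // (def_pblock tiP _ AH) ?setU11.
  rewrite (def_pblock tiP (outP A nAH)) ?set11 // in_set1 eq_sym andNb /=.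
  have [BH | nBH] := boolP (B \in inside_vertices).
    exact: adj_outside_inside.
  apply/andP=> -[/eqP neqAB /exists_inP[a Aa /exists_inP[b Bb /eqP cab]]].
  have := conj_out _ _ (outside_mem nAH Aa) (outside_mem nBH Bb) cab.
  move=> /class_eqP eq_ba; case: neqAB; apply: val_inj.
  have [c _ defA] := vertexP A; have [d _ defB] := vertexP B.
  rewrite defA in Aa *; rewrite defB in Bb *.
  by rewrite -(class_eqP Aa) -eq_ba (class_eqP Bb).
have sizes : perm_eq [seq #|B| | B : {set vertex (ccc_graph G)} <- enum (inside_vertices |: S)]
                     (#|inside_vertices| :: nseq #|Z| 1%N).
  have -> : nseq #|Z| 1%N = [seq #|B| | B : {set ccc_vertex G} <- enum S].
    have <- : #|S| = #|Z| by rewrite card_imset ?card_outside_vertices //; apply: set1_inj.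
    rewrite cardE -(size_map (fun B : {set ccc_vertex G} => #|B|)).
    apply/esym/all_pred1P/allP=> _ /mapP[B BS ->].
    by rewrite mem_enum in BS; have [A _ ->] := SP B BS; rewrite /= cards1.
  rewrite -map_cons; apply/perm_map/uniq_perm.
  - exact: enum_uniq.
  - by rewrite /= mem_enum inP enum_uniq.
  by move=> B; rewrite inE !mem_enum in_setU1.
move: (@CN_spec_cliques C (ccc_graph G) _ partP adjP _ sizes) => /perm_trans; apply.
rewrite map_cons /= perm_cat2l; elim: #|Z| => //= k IHk.
by rewrite {1}/clique_CN_spec /= subrr mul0r perm_cons.
Qed.

(** Here the outer classes are pairwise adjacent, so there are two cliques. *)
Lemma CN_spec_clique_outside (C : numClosedFieldType) :
    inside_vertices != set0 ->
    {in G :\: H &, forall b c, exists2 c', c' \in c ^: G & commute b c'} ->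
  perm_eq (CN_spec C (ccc_graph G))
          (clique_CN_spec C #|inside_vertices| ++ clique_CN_spec C #|Z|).
Proof.
move=> in_neq0 comm_out.
have out_neq0 : ~: inside_vertices != set0.
  by rewrite -card_gt0 card_outside_vertices cardG_gt0.
pose P := [set inside_vertices; ~: inside_vertices].
have neqIO : inside_vertices != ~: inside_vertices.
  apply: contraNneq in_neq0 => eqIO.
  by rewrite -subset0 -(setICr inside_vertices) -eqIO setIid.
have tiP : trivIset P.
  apply/trivIsetP=> A B; rewrite !inE => /orP[]/eqP-> /orP[]/eqP->; rewrite ?eqxx //.
    by rewrite disjoints_subset setCK.
  by rewrite disjoints_subset.
have partP : partition P [set: vertex (ccc_graph G)].
  apply/and3P; split=> //; last by rewrite !inE ![set0 == _]eq_sym negb_or in_neq0.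
  apply/eqP/setP=> A; rewrite [RHS]inE; apply/bigcupP.
  have [AH | nAH] := boolP (A \in inside_vertices).
    by exists inside_vertices; rewrite ?setU11.
  by exists (~: inside_vertices); rewrite ?set22 // inE.
have adjP (A B : vertex (ccc_graph G)) :
    adj A B = (A != B) && (B \in pblock P A).
  have [AH | nAH] := boolP (A \in inside_vertices).
    by rewrite [LHS]adj_inside // (def_pblock tiP _ AH) ?set21.
  have AH' : A \in ~: inside_vertices by rewrite inE.
  rewrite (def_pblock tiP _ AH') ?set22 // inE.
  have [BH | nBH] := boolP (B \in inside_vertices).
    by rewrite andbF; apply: adj_outside_inside.
  rewrite andbT; apply/andb_idr=> _.
  have [a _ defA] := vertexP A; have [b _ defB] := vertexP B.
  have Aa : a \in val A by rewrite defA class_refl.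
  have Bb : b \in val B by rewrite defB class_refl.
  have [c Bc cac] := comm_out _ _ (outside_mem nAH Aa) (outside_mem nBH Bb).
  apply/exists_inP; exists a => //; apply/exists_inP; exists c; last exact/eqP.
  by rewrite defB.
have sizes : perm_eq [seq #|B| | B : {set vertex (ccc_graph G)} <- enum P]
                     [:: #|inside_vertices|; #|Z|].
  rewrite -card_outside_vertices.
  apply: (perm_map (fun B : {set ccc_vertex G} => #|B|)
                   (t := [:: inside_vertices; ~: inside_vertices])).
  apply: uniq_perm; rewrite ?enum_uniq //= ?inE ?neqIO //.
  by move=> B; rewrite mem_enum !inE.
by have := @CN_spec_cliques C (ccc_graph G) _ partP adjP _ sizes; rewrite /= cats0.
Qed.

End AbelianIndexTwo.

(** * From the presentation to the structure of the semidihedral group *)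

Section Presentation.
Local Open Scope group_scope.

(** The relations do not collapse because x |-> x^(2n - 1) is an automorphism of
the cyclic group of order 4n whose square is the identity:
(2n - 1)^2 = (n - 1) 4n + 1.  The model is the resulting semidirect product. *)
Lemma semidihedral_model (n : nat) : (2 <= n)%N ->
  exists gT : finGroupType,
    #|[set: gT]| = (8 * n)%N /\
    [set: gT] \isog Grp (x : y : x ^+ (4 * n)%N, y ^+ 2,
                                 x ^ y = x ^+ (2 * n - 1)%N).
Proof.
move=> n2; have q_gt1 : (1 < 4 * n)%N by lia.
exists (Extremal.gtype (4 * n) 2 (2 * n - 1)).
split; first by rewrite Extremal.card //; lia.
apply: Extremal.Grp => //.
pose e : 'Z_#[Zp1 : 'Z_(4 * n)] := (2 * n - 1)%:R%R.
have oZ : #[Zp1 : 'Z_(4 * n)] = (4 * n)%N by rewrite order_Zp1 Zp_cast.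
have e2 : (e * e = 1)%R.
  rewrite -natrM.
  have -> : ((2 * n - 1) * (2 * n - 1) = (n - 1) * (4 * n) + 1)%N by nia.
  have Z0 : ((4 * n)%:R = 0 :> 'Z_#[Zp1 : 'Z_(4 * n)])%R.
    by rewrite -[LHS](congr1 (fun k => k%:R)%R oZ) pchar_Zp ?oZ.
  by rewrite natrD natrM Z0 mulr0 add0r.
have Ue : e \is a GRing.unit by apply/unitrP; exists e.
pose u := FinRing.unit ('Z_#[Zp1 : 'Z_(4 * n)]) Ue.
exists (Zp_unitm u).
rewrite Aut_aut order_injm ?injm_Zp_unitm ?in_setT //; split=> //.
  by rewrite order_dvdn -val_eqE /= e2.
apply/eqP; rewrite autE ?cycle_id // eq_expg_mod_order /=.
by rewrite val_Zp_nat ?oZ // modn_mod.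
Qed.

(** All that the rest of the argument needs from the presentation: the
generator y can be forgotten, since every element outside <x> acts on <x> in the
same way as y. *)
Lemma semidihedral_structure (n : nat) (gT : finGroupType) (G : {group gT}) :
  (2 <= n)%N ->
  G \isog Grp (x : y : x ^+ (4 * n)%N, y ^+ 2, y * x * y = x ^+ (2 * n - 1)%N) ->
  exists x, [/\ x \in G, #[x] = (4 * n)%N, #|G| = (8 * n)%N
    & {in G :\: <[x]>, forall b, x ^ b = x ^+ (2 * n - 1)}].
Proof.
move=> n2 isoG.
(* The model is a homomorphic image of G. *)
have leG : (8 * n <= #|G|)%N.
  have [rT [<- isoR]] := semidihedral_model n2.
  apply: leq_homg; rewrite isoG.
  have /existsP[[x y] /= /eqP[defR xq y2 xy]] := isoGrp_hom isoR.
  apply/existsP; exists (x, y); rewrite /= !xpair_eqE defR xq y2 !eqxx /=.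
  have yV : y^-1 = y by apply/eqP; rewrite eq_invg_mul -expg2 y2.
  by rewrite -xy conjgE yV mulgA.
have /existsP[[x y] /= /eqP[defG xq y2 yxy]] := isoGrp_hom isoG.
have yV : y^-1 = y by apply/eqP; rewrite eq_invg_mul -expg2 y2.
have xy : x ^ y = x ^+ (2 * n - 1) by rewrite conjgE yV mulgA.
have defG' : <[x]> * <[y]> = G.
  by rewrite -norm_joinEr // norms_cycle xy mem_cycle.
have Gx : x \in G by rewrite -defG mem_gen // inE cycle_id.
have ox : (#[x] <= 4 * n)%N by rewrite dvdn_leq ?order_dvdn ?xq //; lia.
have oy : (#[y] <= 2)%N by rewrite dvdn_leq ?order_dvdn ?y2.
have cG : (#|G| * #|<[x]> :&: <[y]>| = #[x] * #[y])%N.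
  by rewrite -defG' -mul_cardG.
have leGxy : (#|G| <= #[x] * #[y])%N by rewrite -cG leq_pmulr ?cardG_gt0.
have le_xy : (#[x] * #[y] <= #[x] * 2)%N by rewrite leq_mul.
exists x; split=> //.
- by apply/eqP; rewrite eqn_leq ox; have := leq_trans leG (leq_trans leGxy le_xy); lia.
- apply/eqP; rewrite eqn_leq leG andbT (leq_trans leGxy) // (leq_trans le_xy) //.
  by move: ox; lia.
move=> b /setDP[]; rewrite -defG' => /mulsgP[_ _ /cycleP[i ->] /cycleP[j ->] ->].
(* Only the parity of j matters, as y is an involution; for odd j the factor
   x^i acts trivially on x, so that the action is that of y. *)
have -> : y ^+ j = y ^+ (odd j).
  by rewrite -{1}(odd_double_half j) expgD -mul2n expgM y2 expg1n mulg1.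
case: (odd j) => [_ | ]; last by rewrite mulg1 mem_cycle.
by rewrite expg1 conjgM [x ^ _]conjgE commuteX // mulKg.
Qed.

End Presentation.

(** * Centre and classes of the semidihedral group *)

Section SemidihedralGroup.

Local Open Scope group_scope.

Variables (n : nat) (gT : finGroupType) (G : {group gT}) (x : gT).
Hypotheses (n2 : (2 <= n)%N) (Gx : x \in G) (ox : #[x] = (4 * n)%N).
Hypothesis oG : #|G| = (8 * n)%N.
Hypothesis conj_x : {in G :\: <[x]>, forall b, x ^ b = x ^+ (2 * n - 1)}.

Local Notation H := <[x]>%G.

Let sHG : H \subset G. Proof. by rewrite cycle_subG. Qed.

Lemma index_rotations : #|G : H| = 2.
Proof.
by rewrite -divgS //= oG [#|_|]ox (_ : 8 * n = 2 * (4 * n))%N ?mulnK //; lia.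
Qed.

Let iHG := index_rotations.

Let outside_neq0 : exists b, b \in G :\: H.
Proof.
have /subsetPn[b Gb nHb] : ~~ (G \subset H).
  by apply/negP=> /subset_leq_card; rewrite /= oG [#|<[x]>|]ox; lia.
by exists b; rewrite inE nHb.
Qed.

(** Commuting with a single element b outside <x> suffices, and this says that
x^i is fixed by the exponent 2n - 1. *)
Lemma central_power (i : nat) :
  (x ^+ i \in 'Z(G)) = (4 * n %| i * (2 * n - 2))%N.
Proof.
have eq_div : (x ^+ i ^+ (2 * n - 1) == x ^+ i) = (4 * n %| i * (2 * n - 2))%N.
  rewrite -expgM eq_expg_mod_order ox eqn_mod_dvd; last by nia.
  by congr (_ %| _)%N; nia.
rewrite -eq_div; apply/idP/eqP=> [Zi | fix_i].
  have [b GHb] := outside_neq0; have /setDP[Gb _] := GHb.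
  by rewrite expgAC -(conj_x GHb) -conjXg conjgE -(centerC Gb Zi) mulKg.
apply/centerP; split=> [|b Gb]; first by rewrite groupX.
have [Hb | nHb] := boolP (b \in <[x]>).
  by case/cycleP: Hb => j ->; apply: commuteX2.
have GHb : b \in G :\: <[x]> by rewrite inE nHb.
by apply/commgP/conjg_fixP; rewrite conjXg (conj_x GHb) expgAC.
Qed.

Lemma semidihedral_nonabelian : ~~ abelian G.
Proof.
apply/negP=> abG; have : x ^+ 1 \in 'Z(G) by rewrite (center_idP abG).
by rewrite central_power mul1n => /dvdn_leq; lia.
Qed.

(** By [central_power] the condition on i is that 2n divides i(n - 1).  As n is
coprime to n - 1 this means that n divides i when n - 1 is even, and that 2n
divides i when n - 1 is odd. *)
Lemma semidihedral_center :
  'Z(G) = <[x ^+ (if odd n then n else 2 * n)%N]>.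
Proof.
apply/eqP; rewrite eqEsubset cycle_subG central_power; apply/andP; split.
  apply/subsetP=> z Zz.
  have := subsetP (center_sub_index2 sHG (cycle_abelian x) iHG semidihedral_nonabelian) z Zz.
  case/cycleP=> i def_z; rewrite def_z central_power in Zz *.
  suff /dvdnP[k ->] : ((if odd n then n else 2 * n) %| i)%N.
    by rewrite mulnC expgM mem_cycle.
  have : (2 * n %| i * (n - 1))%N.
    rewrite -(@dvdn_pmul2l 2) //; move: Zz.
    by rewrite (_ : i * (2 * n - 2) = 2 * (i * (n - 1)))%N ?mulnA //; nia.
  have cop1 : coprime n (n - 1) by rewrite coprime_sym subn1 coprimePn //; lia.
  case: ifP => odd_n; last first.
    rewrite Gauss_dvdl // coprimeMl cop1 andbT coprime2n oddB ?odd_n //; lia.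
  by move/(dvdn_trans (dvdn_mull 2 (dvdnn n))); rewrite Gauss_dvdl.
case: ifP => odd_n.
  rewrite -[n in (_ %| n * _)%N]odd_double_half odd_n.
  apply/dvdnP; exists n./2; lia.
by apply/dvdnP; exists (n - 1)%N; lia.
Qed.

Lemma card_semidihedral_center : #|'Z(G)| = (if odd n then 4 else 2)%N.
Proof.
rewrite semidihedral_center -orderE orderXdiv ox; case: ifP => _.
- by rewrite mulnK //; lia.
- by rewrite (_ : 4 * n = 2 * (2 * n))%N ?mulnK //; lia.
- exact: dvdn_mull.
- by apply/dvdnP; exists 2; lia.
Qed.

Lemma card_inside_semidihedral :
  #|inside_vertices G H| = (if odd n then 2 * n - 2 else 2 * n - 1)%N.
Proof.
have := card_inside_vertices sHG (cycle_abelian x) iHG semidihedral_nonabelian.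
rewrite card_semidihedral_center [#|<[x]>|]ox; case: (odd n); lia.
Qed.

Lemma outside_quotient (b c : gT) :
  b \in G :\: H -> c \in G :\: H -> exists i, c = b * x ^+ i.
Proof.
move=> GHb GHc; have /setDP[Gb nHb] := GHb.
suff: c \in b *: H by case/lcosetP=> _ /cycleP[i ->] ->; exists i.
rewrite (_ : b *: H = G :\: H) //; apply/eqP; rewrite eqEcard; apply/andP; split.
  apply/subsetP=> _ /lcosetP[h Hh ->]; rewrite inE groupMr // nHb.
  by rewrite groupM // (subsetP sHG).
by rewrite card_lcoset cardsD (setIidPr sHG) oG [#|<[x]>|]ox; lia.
Qed.

(** The conjugate of b by the inverse of x^j. *)
Lemma outside_conjugate (b : gT) (j : nat) :
  b \in G :\: H -> b * x ^+ (j * (2 * n - 2)) \in b ^: G.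
Proof.
move=> GHb; apply/imsetP; exists ((x ^+ j)^-1); first by rewrite groupV groupX.
rewrite conjgE invgK.
have -> : x ^+ j * (b * (x ^+ j)^-1) = b * ((x ^+ j) ^ b * (x ^+ j)^-1).
  by rewrite conjgE !mulgA mulgV mul1g.
rewrite conjXg (conj_x GHb) -expgM; congr (_ * _); apply: (canRL (mulgK _)).
by rewrite -expgD; congr (_ ^+ _); nia.
Qed.

(** An element c outside <x> commuting with b is b z with z central, that is
z = x^(2nk).  Conjugating by x^(-nk) gives b x^(nk(2n - 2)), which is b z because
the exponents differ by 2nk(n - 2), a multiple of 4n for even n. *)
Lemma outside_commute_conjugate : ~~ odd n ->
  {in G :\: H &, forall b c, commute b c -> c \in b ^: G}.
Proof.
move=> even_n b c GHb GHc cbc; have [i def_c] := outside_quotient GHb GHc.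
have : x ^+ i \in 'Z(G).
  apply: (commuting_outside_central sHG (cycle_abelian x) iHG _ GHb).
    exact: mem_cycle.
  by apply: (mulgI b); rewrite -def_c cbc def_c mulgA.
rewrite semidihedral_center (negPf even_n) => /cycleP[k xi].
rewrite -expgM in xi.
rewrite def_c; suff <- : x ^+ (n * k * (2 * n - 2)) = x ^+ i.
  exact: outside_conjugate.
rewrite xi; apply/eqP; rewrite eq_expg_mod_order ox eqn_mod_dvd; last by nia.
have def_n : n = (2 * n./2)%N by rewrite mul2n even_halfK.
apply/dvdnP; exists (k * (n./2 - 1))%N; move: n2 def_n.
by move: n./2 => m m2 ->; nia.
Qed.

(** Writing b = c x^i, a conjugate of c equal to b times a power of x^n is
needed, as x^n is central.  With j = i(n - 1) / 2, conjugation yields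
c x^(j(2n - 2)) = c x^(i(n - 1)^2), and (n - 1)^2 = 1 + n(n - 2). *)
Lemma outside_conjugate_commute : odd n ->
  {in G :\: H &, forall b c, exists2 c', c' \in c ^: G & commute b c'}.
Proof.
move=> odd_n b c GHb GHc; have [i def_c] := outside_quotient GHc GHb.
set c' := c * x ^+ (i * (n - 1)./2 * (2 * n - 2)).
exists c'; first exact: outside_conjugate.
pose z := x ^+ (i * (n * (n - 2))).
have Zz : z \in 'Z(G).
  by rewrite semidihedral_center odd_n /z mulnCA expgM mem_cycle.
have /setDP[Gb _] := GHb.
have -> : c' = b * z.
  rewrite /c' def_c -mulgA -expgD; congr (_ * x ^+ _).
  have def_n : n = (2 * (n - 1)./2 + 1)%N by lia.
  by move: n2 def_n; move: (n - 1)./2 => m m2 def_n; nia.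
by rewrite /commute -mulgA (centerC Gb Zz).
Qed.

End SemidihedralGroup.

(** * Spectrum and energy *)

(** The eigenvalue 2 - k is nonpositive for k >= 2, and for k = 1 it has
multiplicity 0; so the k - 1 copies of it weigh as much as the remaining
eigenvalue (k - 1)(k - 2). *)
Lemma clique_CN_energy (C : numClosedFieldType) (k : nat) : (0 < k)%N ->
  \sum_(a <- clique_CN_spec C k) `|a| = 2 * (k%:R - 1) * (k%:R - 2).
Proof.
case: k => [//|[|k]] _.
  by rewrite /clique_CN_spec /= big_seq1 subrr mul0r normr0 mulr0 mul0r.
have k1 : k.+2%:R - 1 = k.+1%:R :> C by rewrite mulrSr addrK.
have k2 : k.+2%:R - 2 = k%:R :> C by rewrite -addn2 natrD addrK.
rewrite /clique_CN_spec big_cat big_nseq big_seq1 /= -(opprB k.+2%:R) k1 k2.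
rewrite normrN normrM !normr_nat iter_addr_0 -mulr_natl.
by ring.
Qed.

Theorem theorem2p4 (C : numClosedFieldType) (n : nat)
    (gT : finGroupType) (G : {group gT}) :
  (2 <= n)%N ->
  (G \isog Grp (x : y : x ^+ (4 * n)%N, y ^+ 2,
                        y * x * y = x ^+ (2 * n - 1)%N))%g ->
  let m : C := n%:R in
  perm_eq (CN_spec C (ccc_graph G))
    (if ~~ odd n then
       nseq (2 * n - 2) (- (2 * m - 3))
         ++ [:: (2 * m - 2) * (2 * m - 3)] ++ nseq 2 0
     else
       nseq (2 * n - 3) (- (2 * m - 4))
         ++ [:: (2 * m - 3) * (2 * m - 4)] ++ nseq 3 (- 2) ++ [:: 6])
  /\ CN_energy C (ccc_graph G) =
    (if ~~ odd n then 2 * (2 * m - 2) * (2 * m - 3)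
     else 2 * (2 * m - 3) * (2 * m - 4) + 12).
Proof.
move=> n2 isoG m.
have [x [Gx ox oG conj_x]] := semidihedral_structure n2 isoG.
have sHG : <[x]>%g \subset G by rewrite cycle_subG.
have iHG := index_rotations n2 Gx ox oG.
have nabG := semidihedral_nonabelian n2 Gx ox oG conj_x.
have oZ := card_semidihedral_center n2 Gx ox oG conj_x.
have inE := card_inside_semidihedral n2 Gx ox oG conj_x.
have in_neq0 : inside_vertices G <[x]>%G != set0.
  by rewrite -card_gt0 inE; case: ifP; lia.
rewrite /CN_energy; case: ifPn => [even_n | /negbNE odd_n].
  rewrite (negPf even_n) in oZ inE.
  have spec := CN_spec_isolated_outside sHG (cycle_abelian x) iHG nabG C in_neq0
    (outside_commute_conjugate n2 Gx ox oG conj_x even_n).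
  rewrite inE oZ in spec.
  have kE : (2 * n - 1)%:R = 2 * m - 1 by rewrite natrB ?natrM //; lia.
  split.
    apply: (perm_trans spec); rewrite /clique_CN_spec kE -catA.
    have -> : (2 * n - 1).-1 = (2 * n - 2)%N by lia.
    have -> : 2 - (2 * m - 1) = - (2 * m - 3) by ring.
    by have -> : (2 * m - 1 - 1) * (2 * m - 1 - 2) = (2 * m - 2) * (2 * m - 3) by ring.
  rewrite (perm_big _ spec) big_cat big_nseq /= clique_CN_energy; last by lia.
  by rewrite kE normr0; ring.
rewrite odd_n in oZ inE.
have spec := CN_spec_clique_outside sHG (cycle_abelian x) iHG nabG C in_neq0
  (outside_conjugate_commute n2 Gx ox oG conj_x odd_n).
rewrite inE oZ in spec.
have kE : (2 * n - 2)%:R = 2 * m - 2 by rewrite natrB ?natrM //; lia.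
split.
  apply: (perm_trans spec); rewrite /clique_CN_spec kE -catA.
  have -> : (2 * n - 2).-1 = (2 * n - 3)%N by lia.
  have -> : 2 - (2 * m - 2) = - (2 * m - 4) by ring.
  have -> : (2 * m - 2 - 1) * (2 * m - 2 - 2) = (2 * m - 3) * (2 * m - 4) by ring.
  have -> : 2 - 4 = - 2 :> C by ring.
  by have -> : (4 - 1) * (4 - 2) = 6 :> C by ring.
rewrite (perm_big _ spec) big_cat /= !clique_CN_energy //; last by lia.
by rewrite kE; ring.
Qed.
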